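(* Let $F(x,y)$ be an irreducible polynomial over $\mathbb{C}$, and let the curve $F(x,y)=0$ be uniformized by single-valued non-constant analytic functions $x=\chi(\tau)$, $y=\varphi(\tau)$, so that $F(\chi(\tau),\varphi(\tau))=0$ identically. Suppose these functions satisfy $$[x,\tau]=Q_1(x,y),\qquad [y,\tau]=Q_2(x,y),$$ where $Q_1,Q_2$ are rational functions of $x,y$. Then $Q_1$ and $Q_2$ are connected by the linear relation $$\big(Q_1+\{F,x\}\big)\frac{F_y}{F_x}-\big(Q_2+\{F,y\}\big)\frac{F_x}{F_y}=3\left(\ln\frac{F_x}{F_y}\right)_{xy}\qquad \mathrm{mod}\ \langle F(x,y)\rangle,$$ i.e. the equality holds as an identity on the curve $F(x,y)=0$.
   Context: Subscripts denote derivatives; $F_x,F_y$ etc. are partial derivatives of the polynomial $F$ in the independent variables $x,y$. The Schwarzian derivative is $\{x,\tau\}=\frac{x_{\tau\tau\tau}}{x_\tau}-\frac32\left(\frac{x_{\tau\tau}}{x_\tau}\right)^2$, and $[x,\tau]=\frac{1}{x_\tau^2}\{x,\tau\}$ is the meromorphic derivative. The expressions $\{F,x\}=\frac{F_{xxx}}{F_x}-\frac32\left(\frac{F_{xx}}{F_x}\right)^2$ and $\{F,y\}=\frac{F_{yyy}}{F_y}-\frac32\left(\frac{F_{yy}}{F_y}\right)^2$ are partial Schwarzians (with respect to $x$ at fixed $y$, and with respect to $y$ at fixed $x$). The second-order mixed derivative on the right is likewise taken with $x,y$ regarded as independent, before restricting to the curve. *)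

(* Defs.v *)
From HB Require Import structures.
From mathcomp Require Import all_boot all_order all_algebra.
From mathcomp Require Import fraction polyXY.
From mathcomp Require Import all_classical all_reals all_analysis.
From mathcomp Require Import complex ring.

Set Implicit Arguments.
Unset Strict Implicit.
Unset Printing Implicit Defensive.

Import Order.TTheory GRing.Theory Num.Theory.
Import numFieldNormedType.Exports.

Local Open Scope classical_set_scope.
Local Open Scope ring_scope.

(* The complex numbers R[i], typed as a numClosedFieldType so that the norm
   topology and f^`(n), which is then the n-th complex derivative, are found by
   inference. *)
Definition Cplx (R : realType) : numClosedFieldType := R[i]%C.

Section ComplexFunctions.
Context {R : realType}.
Implicit Types (f : Cplx R -> Cplx R) (z : Cplx R) (D : set (Cplx R)).

Definition analytic_at f z :=
  exists (a : nat -> Cplx R) (r : Cplx R), 0 < r /\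
    forall w, `|w - z| < r ->
      series (fun n => a n * (w - z) ^+ n) @ \oo --> f w.

(* No value is assigned at a pole: a meromorphic function is analytic on the
   domain obtained by deleting its poles. *)
Definition analytic_on D f := forall z, z \in D -> analytic_at f z.

Definition domain D := open D /\ connected D.

Definition nonconstant_on D f := ~ exists c, forall z, z \in D -> f z = c.

Definition schwarzian f z : Cplx R :=
  f^`(3)%classic z / f^`(1)%classic z
    - 3%:R / 2%:R * (f^`(2)%classic z / f^`(1)%classic z) ^+ 2.

Definition mero_derivative f z : Cplx R :=
  (f^`(1)%classic z ^+ 2)^-1 * schwarzian f z.

End ComplexFunctions.

Section Ideal.
Context {A : idomainType}.
Implicit Types F p : A.

Definition in_ideal F p := exists q, p = F * q.

(* Irreducible element of an integral domain; MathComp's irreducible_poly is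
   only meaningful for univariate polynomials over a field. *)
Definition irreducible F :=
  [/\ F != 0, F \isn't a GRing.unit
    & forall p q : A, F = p * q ->
        p \is a GRing.unit \/ q \is a GRing.unit].

End Ideal.

(* Polynomials in x, y: as in polyXY, x is the outer variable 'X and y is the
   inner variable 'Y, so that p.[x, y] is the value of p at (x, y). *)
Notation poly2 K := {poly {poly K}}.
Notation ratfun K := {fraction {poly {poly K}}}.
Notation "p %:F" := (@FracField.tofrac _ p) : ring_scope.

Section RationalFunctions.
Context {K : fieldType}.
Implicit Types (p n m F : poly2 K) (Q G : ratfun K).

Definition polyDx p : poly2 K := p^`().
Definition polyDy p : poly2 K := map_poly (@deriv K) p.

(* Extension of a derivation of K[x, y] to K(x, y) by the quotient rule, on the
   chosen representative of a fraction; by fracDE the choice is irrelevant. *)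
Definition fracD (d : poly2 K -> poly2 K) Q : ratfun K :=
  let n := (frac (repr Q)).1 in let m := (frac (repr Q)).2 in
  (d n * m - n * d m)%:F / (m ^+ 2)%:F.

Definition Dx : ratfun K -> ratfun K := fracD polyDx.
Definition Dy : ratfun K -> ratfun K := fracD polyDy.

Lemma polyDxM n m : polyDx (n * m) = polyDx n * m + n * polyDx m.
Proof. exact: derivM. Qed.

Lemma polyDyM n m : polyDy (n * m) = polyDy n * m + n * polyDy m.
Proof.
apply/polyP => i; rewrite coefD !coefM coef_map_id0 ?deriv0 // coefM.
rewrite linear_sum -big_split /=; apply: eq_bigr => j _.
by rewrite derivM !coef_map_id0 ?deriv0.
Qed.

Lemma tofrac_repr Q : Q = ((frac (repr Q)).1)%:F / ((frac (repr Q)).2)%:F.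
Proof.
rewrite -[LHS]reprK; set r := repr Q.
have dn0 : (frac r).2 != 0 := denom_ratioP r.
have: (\pi_({fraction poly2 K})%qT r : {fraction _}) * ((frac r).2)%:F = ((frac r).1)%:F.
  unlock FracField.tofrac; rewrite -[LHS]FracField.pi_mul.
  apply/eqmodP; rewrite /= FracField.equivfE /FracField.mulf.
  by rewrite !numden_Ratio ?mulr1 ?oner_eq0 ?mulf_neq0 ?oner_eq0 // mulrC.
by move=> <-; rewrite mulfK // tofrac_eq0.
Qed.

Lemma fracDE (d : poly2 K -> poly2 K)
    (dM : forall n m, d (n * m) = d n * m + n * d m) n m : m != 0 ->
  fracD d (n%:F / m%:F) = (d n * m - n * d m)%:F / (m ^+ 2)%:F.
Proof.
move=> m0; rewrite /fracD; set Q := n%:F / m%:F.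
set n' := (frac (repr Q)).1; set m' := (frac (repr Q)).2.
have m'0 : m' != 0 := denom_ratioP (repr Q).
have E : n' * m = n * m'.
  have := tofrac_repr Q; rewrite -/n' -/m' {1}/Q => /eqP.
  rewrite eqr_div ?tofrac_eq0 // -!tofracM tofrac_eq => /eqP ->.
  by [].
have dE : d n' * m + n' * d m = d n * m' + n * d m' by rewrite -!dM E.
apply/eqP; rewrite eqr_div ?tofrac_eq0 ?expf_neq0 // -!tofracM tofrac_eq.
apply/eqP.
transitivity (m * m' * (d n' * m) - (n' * m) * (m * d m')); first by ring.
have -> : d n' * m = d n * m' + n * d m' - n' * d m by rewrite -dE addrK.
transitivity (m * m' * (d n * m' + n * d m') - m' * d m * (n' * m)
  - (n' * m) * (m * d m')); first by ring.
by rewrite E; ring.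
Qed.

Lemma Dx_tofrac p : Dx p%:F = (polyDx p)%:F.
Proof.
rewrite -[p%:F]divr1 -tofrac1 /Dx (fracDE polyDxM) ?oner_eq0 //.
by rewrite [polyDx 1]derivC mulr0 subr0 mulr1 expr1n tofrac1 divr1.
Qed.

Lemma Dy_tofrac p : Dy p%:F = (polyDy p)%:F.
Proof.
rewrite -[p%:F]divr1 -tofrac1 /Dy (fracDE polyDyM) ?oner_eq0 //.
have -> : polyDy 1 = 0 by rewrite /polyDy -polyC1 map_polyC /= derivC.
by rewrite mulr0 subr0 mulr1 expr1n tofrac1 divr1.
Qed.

(* Q takes the value v at (x, y): some representation of Q as a quotient has a
   denominator not vanishing there. *)
Definition has_value Q (x y v : K) :=
  exists n m : poly2 K,
    [/\ m.[x, y] != 0, Q = n%:F / m%:F & v = n.[x, y] / m.[x, y]].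

(* The denominator of Q does not vanish identically on F = 0, i.e. Q restricts
   to a rational function on the curve. *)
Definition defined_on_curve F Q :=
  exists n m : poly2 K, ~ in_ideal F m /\ Q = n%:F / m%:F.

(* Equality of rational functions on the curve F = 0: their difference lies in
   the ideal generated by F in the ring of the Q with defined_on_curve F Q. *)
Definition eq_mod F Q1 Q2 :=
  exists n m : poly2 K, ~ in_ideal F m /\ Q1 - Q2 = (F * n)%:F / m%:F.

Definition partial_schwarzian (D : ratfun K -> ratfun K) G : ratfun K :=
  D (D (D G)) / D G - 3%:R / 2%:R * (D (D G) / D G) ^+ 2.

(* (ln G)_xy, with (ln G)_x = G_x / G. *)
Definition ln_xy G : ratfun K := Dy (Dx G / G).

End RationalFunctions.

(* [f, tau] = Q(chi, phi), at every point of the domain where both sides are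
   defined. *)
Definition satisfies_ode (R : realType) (D : set (Cplx R))
    (chi phi f : Cplx R -> Cplx R) (Q : ratfun (Cplx R)) :=
  forall tau v, tau \in D -> f^`(1)%classic tau != 0 ->
    has_value Q (chi tau) (phi tau) v -> mero_derivative f tau = v.

(* Main.v *)
Require Import Defs.
From mathcomp Require Import all_boot all_order all_algebra.
From mathcomp Require Import fraction polyXY.
From mathcomp Require Import all_classical all_reals all_analysis.
From mathcomp Require Import complex ring.
Import Order.TTheory GRing.Theory Num.Theory.
Import numFieldNormedType.Exports.
Local Open Scope classical_set_scope.
Local Open Scope ring_scope.

Set Implicit Arguments.
Unset Strict Implicit.
Unset Printing Implicit Defensive.

(* Differentiating F(chi, phi) = 0 three times expresses the first three
   derivatives of phi through those of chi and the partial derivatives of F.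
   Substituting them into the two equations [x,tau] = Q1, [y,tau] = Q2
   eliminates the derivatives of chi and leaves the asserted relation, as a field
   identity, at every point (chi tau, phi tau) where the denominators and the
   first derivatives of chi and phi do not vanish.  If a polynomial N is not
   divisible by the irreducible F, then some combination of N and F is a nonzero
   polynomial h(y) (the resultant, by Gauss' lemma); such an h cannot vanish
   along the nonconstant phi.  Hence the numerator of the relation is divisible
   by F and its denominator is not. *)

(** * Divisibility by an irreducible bivariate polynomial *)

Section Gauss.
Variable K : closedFieldType.
Implicit Types (c d : {poly K}) (F g h N : poly2 K).

(** Setting y = a kills every coefficient of [g], each a polynomial in y, so y - a can be divided
    out coefficient by coefficient. *)
Lemma eval_inner_eq0 (a : K) g : map_poly (horner_eval a) g = 0 ->
  exists g', g = ('X - a%:P)%:P * g'.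
Proof.
move=> g0; have gi i : exists q : {poly K}, g`_i = q * ('X - a%:P).
  by apply/factor_theorem/rootP; have /polyP/(_ i) := g0; rewrite coef_map coef0.
exists (\poly_(i < size g) (g`_i %/ ('X - a%:P))).
apply/polyP => i; rewrite coefCM coef_poly.
case: ltnP => [_|lei]; last by rewrite nth_default ?mulr0.
by have [q ->] := gi i; rewrite mulpK ?polyXsubC_eq0 // mulrC.
Qed.

(** Gauss' lemma as a distribution of the content. At a root a of [c], the substitution y = a sends
    [g * h] to zero in the domain K[x], so y - a divides [g] or [h] and can be cancelled; induction
    on the degree of [c] does the rest. *)
Lemma gauss_split c F g h : c != 0 -> c%:P * F = g * h ->
  exists c1 c2 g1 h1,
    [/\ c1 * c2 = c, g = c1%:P * g1, h = c2%:P * h1 & F = g1 * h1].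
Proof.
have [n] := ubnP (size c); elim: n c g h => // n IHn c g h le_c c0 E.
have [/size_poly1P[u u0 cu]|nc] := boolP (size c == 1).
  have uu : u%:P * (u^-1)%:P = 1 :> {poly K} by rewrite -polyCM divff.
  (* A constant [c] is invertible, so all of it can be charged to [g]. *)
  exists c, 1, ((u^-1)%:P%:P * g), h; split; rewrite ?mulr1 ?mul1r //.
    by rewrite mulrA -polyCM cu uu mul1r.
  by rewrite -mulrA -E mulrA -polyCM cu [_ * u%:P]mulrC uu mul1r.
have [a /factor_theorem[d cd]] := closed_rootP c nc.
have d0 : d != 0 by apply: contraNneq c0 => d0; rewrite cd d0 mul0r.
have sz : (size d < n)%N.
  by move: le_c; rewrite cd size_mul ?polyXsubC_eq0 // size_XsubC addn2.
have X0 : ('X - a%:P)%:P != 0 :> poly2 K by rewrite polyC_eq0 polyXsubC_eq0.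
have : map_poly (horner_eval a) g * map_poly (horner_eval a) h = 0.
  rewrite -rmorphM -E rmorphM /= map_polyC /= /horner_eval cd.
  by rewrite hornerM hornerXsubC subrr mulr0 mul0r.
move/eqP; rewrite mulf_eq0 => /orP[] /eqP /eval_inner_eq0[k kE].
  have : d%:P * F = k * h.
    by apply: (mulfI X0); rewrite mulrA -polyCM [_ * d]mulrC -cd E kE mulrA.
  case/(IHn _ _ _ sz d0) => c1 [c2 [g1 [h1 [dE k1 -> ->]]]].
  exists (('X - a%:P) * c1), c2, g1, h1; split => //.
    by rewrite -mulrA dE cd mulrC.
  by rewrite kE k1 polyCM mulrA.
have : d%:P * F = g * k.
  by apply: (mulfI X0); rewrite mulrA -polyCM [_ * d]mulrC -cd E kE mulrCA.
case/(IHn _ _ _ sz d0) => c1 [c2 [g1 [h1 [dE -> k1 ->]]]].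
exists c1, (('X - a%:P) * c2), g1, h1; split => //.
  by rewrite mulrCA dE cd mulrC.
by rewrite kE k1 polyCM mulrA.
Qed.

Lemma unit_size1 g : g \is a GRing.unit -> size g = 1%N.
Proof. by rewrite poly_unitE => /andP[/eqP]. Qed.

(** The resultant in x is the combination sought unless it vanishes. If it vanishes, the pseudo-gcd
    of [F] and [N] has positive degree in x. A first use of [gauss_split] shows that [F] is a unit
    times a factor of this gcd, a second one that [F] divides [N]. *)
Lemma coprime_elim F N : irreducible F -> (1 < size F)%N -> ~ in_ideal F N ->
  exists2 c : {poly K}, c != 0 & exists u v, c%:P = u * F + v * N.
Proof.
move=> [F0 Fnu Firr] sF nFN.
have N0 : N != 0 by apply/eqP => N0; apply: nFN; exists 0; rewrite mulr0.
have [sN|sN] := leqP (size N) 1.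
  rewrite (size1_polyC sN) in N0 *; exists N`_0; first by rewrite polyC_eq0 in N0.
  by exists 0, 1; rewrite mul0r mul1r add0r.
have [r0|r0] := eqVneq (resultant F N) 0; last first.
  exists (resultant F N) => //.
  by have [[u v] /= _ ->] := resultant_in_ideal sF sN; exists u, v.
case: nFN; move/eqP: r0; rewrite resultant_eq0 => sg.
set g := gcdp F N in sg.
have lc p : g %| p -> exists2 c : {poly K}, c != 0 & exists q, c%:P * p = q * g.
  case/Pdiv.Idomain.dvdpP => [[c q] /= c0 E].
  by exists c => //; exists q; rewrite mul_polyC.
have [c c0 [h hE]] := lc _ (dvdp_gcdl F N).
have [c' c'0 [h' h'E]] := lc _ (dvdp_gcdr F N).
have [c1 [c2 [h1 [g1 [_ _ gE FE]]]]] := gauss_split c0 hE.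
have c2g0 : c2%:P * g1 != 0 by rewrite -gE -size_poly_gt0 (ltn_trans _ sg).
have c20 : c2%:P != 0 :> poly2 K by apply: contraNneq c2g0 => ->; rewrite mul0r.
have sg1 : (1 < size g1)%N.
  by move: sg; rewrite gE mul_polyC size_scale // -polyC_eq0.
have uh1 : h1 \is a GRing.unit.
  have [//|/unit_size1 s1] := Firr _ _ FE.
  by rewrite s1 in sg1.
have : c'%:P * N = h' * c2%:P * h1^-1 * F.
  by rewrite h'E gE FE -!mulrA [h1^-1 * _]mulrA mulVr // mul1r.
case/(gauss_split c'0) => d1 [d2 [k1 [F1 [_ _ FE2 NE]]]].
(* [F1] cannot be the unit, since [F] has positive degree in x; hence [d2] is, and [F] divides
   [N]. *)
have [ud|/unit_size1 s1] := Firr _ _ FE2; last first.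
  have d20 : d2 != 0 by apply: contraNneq F0 => d20; rewrite FE2 d20 mul0r.
  by move: sF; rewrite FE2 mul_polyC size_scale // s1.
exists (d2%:P^-1 * k1); rewrite {1}FE2 NE; move: ud; set e := _%:P => ud.
by rewrite [e * _]mulrC -mulrA [e * _]mulrA divrr // mul1r mulrC.
Qed.
End Gauss.

(** * Divisibility of the partial derivatives of a polynomial by the polynomial itself *)

Section DerivativeIdeal.
Variable K : numFieldType.
Implicit Types F : poly2 K.

(** The derivative has smaller degree in x, so divisibility by [F] forces it to vanish; in
    characteristic zero [F] is then free of x. *)
Lemma in_ideal_polyDx F : in_ideal F (polyDx F) -> (size F <= 1)%N.
Proof.
move=> [q E]; have [D0|D0] := eqVneq (polyDx F) 0; last first.
  have q0 : q != 0 by apply: contraNneq D0 => q0; rewrite E q0 mulr0.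
  have F0 : F != 0 by apply: contraNneq D0 => F0; rewrite E F0 mul0r.
  have := lt_size_deriv F0; rewrite -[F^`()]/(polyDx F) E size_mul //.
  by case: (size q) (size_poly_gt0 q) => [|n _]; rewrite ?q0 // addnS /= ltnNge leq_addr.
apply/leq_sizeP => -[//|i] _; move/polyP/(_ i): D0.
rewrite coef_deriv coef0 -mulr_natl => /eqP; rewrite mulf_eq0.
by rewrite -polyC_natr polyC_eq0 pnatr_eq0 /= => /eqP.
Qed.

Lemma polyDy_swap F : polyDy F = swapXY (polyDx (swapXY F)).
Proof.
apply/polyP => i; apply/polyP => j.
rewrite coef_map_id0 ?deriv0 // coef_deriv coef_swapXY coef_deriv.
by rewrite coefMn coef_swapXY.
Qed.

Lemma in_ideal_polyDy F : in_ideal F (polyDy F) -> (size (swapXY F) <= 1)%N.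
Proof.
move=> [q E]; apply: in_ideal_polyDx; exists (swapXY q).
by rewrite -[LHS]swapXYK -polyDy_swap E rmorphM.
Qed.

Lemma horner2_size1 F x y : (size F <= 1)%N -> F.[x, y] = (F`_0).[y].
Proof. by move=> /size1_polyC ->; rewrite hornerC coefC. Qed.

Lemma factor_polyC_root F (x : K) : F.[x%:P] = 0 -> exists q, F = q * ('X - x%:P%:P).
Proof. by move=> /rootP/factor_theorem. Qed.

Lemma unit_horner2_neq0 (F : poly2 K) x y : F \is a GRing.unit -> F.[x, y] != 0.
Proof.
move=> uF; apply/eqP => F0; have := mulVr uF => /(congr1 (fun p : poly2 K => p.[x, y])).
by rewrite !hornerM F0 mulr0 !hornerC => /esym/eqP; rewrite oner_eq0.
Qed.

Lemma polyXsubC_non_unit (c : {poly K}) : 'X - c%:P \isn't a GRing.unit.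
Proof. by rewrite poly_unitE size_XsubC. Qed.
End DerivativeIdeal.

(** * The relation as a field identity *)

(* X, Y, XX, ..., YYY stand for the partial derivatives of F and Qi = ni / mi;
   u / w is the logarithmic x-derivative of F_x / F_y. *)
Definition relation_num (A : comPzRingType) (n1 m1 n2 m2 X Y XX XY YY XXX XXY XYY YYY : A) : A :=
  let u := XX * Y - X * XY in
  let uy := XXY * Y + XX * YY - XY * XY - X * XYY in
  let w := X * Y in
  let wy := XY * Y + X * YY in
  2%:R * n1 * m2 * X ^+ 2 * Y ^+ 4 - 2%:R * n2 * m1 * X ^+ 4 * Y ^+ 2
  + m1 * m2 * ((2%:R * XXX * X - 3%:R * XX ^+ 2) * Y ^+ 4
    - (2%:R * YYY * Y - 3%:R * YY ^+ 2) * X ^+ 4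
    - 6%:R * X * Y * (uy * w - u * wy)).

(** Puts the asserted relation over a common denominator. The term with factor 3 on the left is (u /
    w)_y expanded by the quotient rule. *)
Lemma relation_numE (L : fieldType) (n1 m1 n2 m2 X Y XX XY YY XXX XXY XYY YYY : L) :
  2%:R != 0 :> L -> m1 != 0 -> m2 != 0 -> X != 0 -> Y != 0 ->
  (n1 / m1 + (XXX / X - 3%:R / 2%:R * (XX / X) ^+ 2)) * (Y / X)
  - (n2 / m2 + (YYY / Y - 3%:R / 2%:R * (YY / Y) ^+ 2)) * (X / Y)
  - 3%:R * (((XXY * Y + XX * YY - (XY * XY + X * XYY)) * (X * Y)
              - (XX * Y - X * XY) * (XY * Y + X * YY)) / (X * Y) ^+ 2)
  = relation_num n1 m1 n2 m2 X Y XX XY YY XXX XXY XYY YYY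
     / (2%:R * m1 * m2 * X ^+ 3 * Y ^+ 3).
Proof. by move=> t0 m10 m20 X0 Y0; rewrite /relation_num; field; rewrite t0 m10 m20 X0 Y0. Qed.

(** The three differentiated curve equations are linear in [y1], [y2], [y3] in turn, each time with
    coefficient [Y], and the two Schwarzian equations give [n1] and [n2]. After substitution the
    claim is a rational identity in which [x1], [x2], [x3] cancel. *)
Lemma relation_num_eq0 (L : fieldType) (n1 m1 n2 m2 X Y XX XY YY XXX XXY XYY YYY
    x1 x2 x3 y1 y2 y3 : L) :
  2%:R != 0 :> L -> m1 != 0 -> m2 != 0 -> X != 0 -> Y != 0 ->
  x1 != 0 -> y1 != 0 ->
  X * x1 + Y * y1 = 0 ->
  XX * x1 ^+ 2 + 2%:R * XY * x1 * y1 + YY * y1 ^+ 2 + X * x2 + Y * y2 = 0 ->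
  XXX * x1 ^+ 3 + 3%:R * XXY * x1 ^+ 2 * y1 + 3%:R * XYY * x1 * y1 ^+ 2
    + YYY * y1 ^+ 3 + 3%:R * XX * x1 * x2 + 3%:R * XY * (x1 * y2 + x2 * y1)
    + 3%:R * YY * y1 * y2 + X * x3 + Y * y3 = 0 ->
  (x1 ^+ 2)^-1 * (x3 / x1 - 3%:R / 2%:R * (x2 / x1) ^+ 2) = n1 / m1 ->
  (y1 ^+ 2)^-1 * (y3 / y1 - 3%:R / 2%:R * (y2 / y1) ^+ 2) = n2 / m2 ->
  relation_num n1 m1 n2 m2 X Y XX XY YY XXX XXY XYY YYY = 0.
Proof.
move=> t0 m10 m20 X0 Y0 x10 y10 e1 e2 e3 q1 q2.
have solve a b c : a + Y * b = 0 -> c = - a / Y -> b = c.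
  by move=> /eqP; rewrite addr_eq0 => /eqP -> ->; rewrite opprK mulrC mulKf.
have y1E := solve _ _ _ e1 erefl; have y2E := solve _ _ _ e2 erefl.
have y3E := solve _ _ _ e3 erefl.
have n1E : n1 = n1 / m1 * m1 by rewrite divfK.
have n2E : n2 = n2 / m2 * m2 by rewrite divfK.
rewrite n1E n2E -q1 -q2 /relation_num y3E y2E y1E.
by field; rewrite Y0 oppr_eq0 mulf_neq0 ?t0.
Qed.

Lemma relation_num_rmorph (A B : comPzRingType) (f : {rmorphism A -> B})
    (n1 m1 n2 m2 X Y XX XY YY XXX XXY XYY YYY : A) :
  f (relation_num n1 m1 n2 m2 X Y XX XY YY XXX XXY XYY YYY) =
  relation_num (f n1) (f m1) (f n2) (f m2) (f X) (f Y) (f XX) (f XY) (f YY)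
    (f XXX) (f XXY) (f XYY) (f YYY).
Proof.
by rewrite /relation_num !(rmorphXn, rmorph_nat, rmorphM, rmorphB, rmorphD).
Qed.

Lemma log_derivative_frac (L : fieldType) (u X Y : L) : X != 0 -> Y != 0 ->
  u / Y ^+ 2 / (X / Y) = u / (X * Y).
Proof. by move=> X0 Y0; field; rewrite X0 Y0. Qed.

Lemma polyDxDy (K : fieldType) (F : poly2 K) : polyDx (polyDy F) = polyDy (polyDx F).
Proof.
by apply/polyP => i; rewrite coef_deriv !coef_map_id0 ?deriv0 // coef_deriv derivMn.
Qed.

Lemma polyDyB (K : fieldType) (F G : poly2 K) : polyDy (F - G) = polyDy F - polyDy G.
Proof.
by apply/polyP => i; rewrite coefB !coef_map_id0 ?deriv0 // coefB derivB.
Qed.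

(** Mixed partials are normalized to differentiate in x first; [polyDxDy] brings the others to this
    form. *)
Definition curve_relation (K : fieldType) (F n1 m1 n2 m2 : poly2 K) : poly2 K :=
  relation_num n1 m1 n2 m2 (polyDx F) (polyDy F) (polyDx (polyDx F))
    (polyDy (polyDx F)) (polyDy (polyDy F)) (polyDx (polyDx (polyDx F)))
    (polyDy (polyDx (polyDx F))) (polyDy (polyDy (polyDx F)))
    (polyDy (polyDy (polyDy F))).

Lemma curve_relationE (K : numFieldType) (F n1 m1 n2 m2 : poly2 K) :
  let Fx := Dx F%:F in let Fy := Dy F%:F in
  m1 != 0 -> m2 != 0 -> polyDx F != 0 -> polyDy F != 0 ->
  (n1%:F / m1%:F + partial_schwarzian (@Dx K) F%:F) * (Fy / Fx)
    - (n2%:F / m2%:F + partial_schwarzian (@Dy K) F%:F) * (Fx / Fy)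
    - 3%:R * ln_xy (Fx / Fy)
  = (curve_relation F n1 m1 n2 m2)%:F
      / (2%:R * m1 * m2 * polyDx F ^+ 3 * polyDy F ^+ 3)%:F.
Proof.
move=> Fx Fy m10 m20 X0 Y0.
have t0 : 2%:R != 0 :> ratfun K.
  rewrite -(rmorph_nat (@FracField.tofrac _)) tofrac_eq0.
  by rewrite -!polyC_natr !polyC_eq0 pnatr_eq0.
have XY0 : polyDx F * polyDy F != 0 by rewrite mulf_neq0.
have X0' : (polyDx F)%:F != 0 :> ratfun K by rewrite tofrac_eq0.
have Y0' : (polyDy F)%:F != 0 :> ratfun K by rewrite tofrac_eq0.
have m10' : m1%:F != 0 :> ratfun K by rewrite tofrac_eq0.
have m20' : m2%:F != 0 :> ratfun K by rewrite tofrac_eq0.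
rewrite /partial_schwarzian /Fx /Fy !(Dx_tofrac, Dy_tofrac).
have -> : ln_xy ((polyDx F)%:F / (polyDy F)%:F) =
  ((polyDy (polyDx (polyDx F)) * polyDy F + polyDx (polyDx F) * polyDy (polyDy F)
     - (polyDy (polyDx F) * polyDy (polyDx F) + polyDx F * polyDy (polyDy (polyDx F))))
     * (polyDx F * polyDy F)
   - (polyDx (polyDx F) * polyDy F - polyDx F * polyDy (polyDx F))
     * (polyDy (polyDx F) * polyDy F + polyDx F * polyDy (polyDy F)))%:F
   / ((polyDx F * polyDy F) ^+ 2)%:F.
  rewrite /ln_xy {1}/Dx (fracDE (@polyDxM K)) // polyDxDy.
  set u := _ - _.
  have -> : u%:F / (polyDy F ^+ 2)%:F / ((polyDx F)%:F / (polyDy F)%:F) =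
            u%:F / (polyDx F * polyDy F)%:F.
    rewrite tofracXn.
    rewrite tofracM.
    exact: (log_derivative_frac _ X0' Y0').
  rewrite /Dy (fracDE (@polyDyM K)) // /u polyDyB !polyDyM.
  by [].
rewrite /curve_relation relation_num_rmorph.
rewrite !(rmorphXn, rmorph_nat, rmorphM, rmorphB, rmorphD) /=.
exact: (relation_numE _ _ _ _ _ _ _ _ _ t0 m10' m20' X0' Y0').
Qed.

(** * Complex power series *)

Section PowerSeries.
Variable R : realType.
Local Notation C := (Cplx R).
Implicit Types (a : nat -> C) (f g : C -> C) (z w h r B : C).

Lemma normc_le_ReIm (x : R[i]) : `|x| <= (`|complex.Re x| + `|complex.Im x|)%:C%C.
Proof.
rewrite {1}[x]complexE (le_trans (ler_normD _ _)) // rmorphD /= normrM.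
have -> : `|'i%C| = 1 :> R[i] by rewrite normc_def /= expr0n add0r expr1n sqrtr1.
by rewrite mul1r lerD // normc_def /= expr0n addr0 sqrtr_sqr lexx.
Qed.

Lemma cvg_real_series_bounded (u : nat -> R) (M : R) :
  (forall n, \sum_(k < n) `|u k| <= M) -> cvgn (series u).
Proof.
move=> uM; apply: normed_cvg; apply: nondecreasing_is_cvgn.
  by apply: nondecreasing_series => * /=; exact: normr_ge0.
by exists M => _ [n _ <-]; have := uM n; rewrite -(big_mkord xpredT (fun k => `|u k|)).
Qed.

(** Real and imaginary parts are dominated by the modulus, so both are absolutely convergent real
    series; their limits are recombined. *)
Lemma cvg_series_absolute a B : (forall n, \sum_(k < n) `|a k| <= B) ->
  exists l : C, series a @ \oo --> l.
Proof.
move=> aB.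
have aux (p : C -> R) : (forall x, (`|p x|)%:C%C <= `|x| :> R[i]) ->
    cvgn (series (p \o a)).
  move=> px; apply: (@cvg_real_series_bounded _ (complex.Re (B : R[i]))) => n.
  have : (\sum_(k < n) `|p (a k)|)%:C%C <= (B : R[i]).
    apply: le_trans (aB n); rewrite rmorph_sum /=.
    by apply: ler_sum => k _; exact: px.
  by rewrite lecE => /andP[].
have /cvg_ex[/= l1 u1] : cvgn (series ((@complex.Re R : C -> R) \o a)).
  by apply: aux => x; exact: normc_ge_Re.
have /cvg_ex[/= l2 u2] : cvgn (series ((@complex.Im R : C -> R) \o a)).
  (* The imaginary part is, up to sign, the real part of [x * 'i]. *)
  apply: aux => x; have := normc_ge_Re ((x : R[i]) * 'i%C).
  rewrite ReiNIm normrN normrM.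
  have -> : `|'i%C| = 1 :> R[i] by rewrite normc_def /= expr0n add0r expr1n sqrtr1.
  by rewrite mulr1.
exists ((l1 +i* l2)%C : C). apply/(@cvgrPdist_lt C C) => e e0.
have [e' ee'] : exists e' : R, e = e'%:C%C.
  by apply/complex_realP; rewrite realE (ltW e0).
have e'0 : 0 < e' / 2 by rewrite divr_gt0 //; move: e0; rewrite ee' ltcR.
near=> n.
apply: le_lt_trans (normc_le_ReIm _) _.
rewrite ee' ltcR (splitr e').
have -> : complex.Re ((l1 +i* l2)%C - series a n) = l1 - series ((@complex.Re R : C -> R) \o a) n.
  by rewrite raddfB /= /series /= raddf_sum.
have -> : complex.Im ((l1 +i* l2)%C - series a n) = l2 - series ((@complex.Im R : C -> R) \o a) n.
  by rewrite raddfB /= /series /= raddf_sum.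
apply: ltrD; near: n.
  by move/cvgrPdist_lt: u1 => /(_ _ e'0).
by move/cvgrPdist_lt: u2 => /(_ _ e'0).
Unshelve. all: by end_near. Qed.

Lemma cvg_norm_le (u : nat -> C) l B : (forall n, `|u n| <= B) ->
  u @ \oo --> l -> `|l| <= B.
Proof.
move=> uB ul; have B0 : 0 <= B by apply: le_trans (uB 0%N).
rewrite real_leNgt ?normr_real ?ger0_real //; apply/negP => Bl.
move/cvgrPdist_lt: ul => /(_ (`|l| - B)).
rewrite subr_gt0 => /(_ Bl) [N _ /(_ N (leqnn _))] /= lN.
suff : `|l| < `|l| by rewrite ltxx.
apply: (@le_lt_trans _ _ (`|l - u N| + B)); last by rewrite -ltrBrDr.
by rewrite -{1}(subrK (u N) l) (le_trans (ler_normD _ _)) // lerD2l.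
Qed.

(** Absolute convergence on all smaller discs, phrased by bounded partial sums so that no limit has
    to be named. *)
Definition abs_bounded a r := forall rho, 0 <= rho -> rho < r ->
  exists B, forall n, \sum_(k < n) `|a k| * rho ^+ k <= B.

Definition has_series a f z r := forall w, `|w - z| < r ->
  series (fun n => a n * (w - z) ^+ n) @ \oo --> f w.

Definition dcoef a : nat -> C := fun n => n.+1%:R * a n.+1.

Lemma cvg_terms_bounded (u : nat -> C) (l : C) : series u @ \oo --> l ->
  exists M, forall n, `|u n| <= M.
Proof.
move=> ul; have : u @ \oo --> (0 : C).
  by apply: cvg_series_cvg_0; apply/cvg_ex; exists l.
move/(@cvgrPdist_lt C C) => /(_ 1 ltr01)[N _ uN].
(* Past [N] the terms are below 1; each earlier one is below the sum of them all. *)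
exists (1 + \sum_(k < N) `|u k|) => n.
have s0 : 0 <= \sum_(k < N) `|u k| by apply: sumr_ge0.
have [nN|Nn] := ltnP n N; last first.
  have := uN n Nn; rewrite /= sub0r normrN => /ltW /le_trans; apply.
  by rewrite lerDl.
rewrite (bigD1 (Ordinal nN)) //= addrCA lerDl addr_ge0 ?ler01 //.
by apply: sumr_ge0.
Qed.

Lemma geometric_sum_le (q : C) n : 0 <= q -> q < 1 ->
  \sum_(k < n) q ^+ k <= (1 - q)^-1.
Proof.
move=> q0 q1; have d0 : 0 < 1 - q by rewrite subr_gt0.
rewrite -[leRHS]mul1r ler_pdivlMr // mulrC -opprB mulNr -subrX1 opprB.
by rewrite lerBlDr lerDl exprn_ge0.
Qed.

(** Abel's argument: convergence at distance [s], midway between [rho] and [r], bounds the terms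
    there, and at radius [rho] the terms are then dominated by a geometric series of ratio
    [rho / s]. *)
Lemma has_series_abs_bounded a f z r : has_series a f z r -> abs_bounded a r.
Proof.
move=> af rho rho0 rr; set s := (rho + r) / 2%:R.
have rs : rho < s by rewrite midf_lt.
have sr : s < r by rewrite midf_lt.
have s0 : 0 < s by apply: le_lt_trans rs.
have := af (z + s); rewrite addrAC subrr add0r ger0_norm ?(ltW s0) // => /(_ sr).
move/cvg_terms_bounded => [M aM].
have M0 : 0 <= M by apply: le_trans (aM 0%N).
exists (M * (1 - rho / s)^-1) => n.
have q1 : rho / s < 1 by rewrite ltr_pdivrMr // mul1r.
apply: (@le_trans _ _ (\sum_(k < n) M * (rho / s) ^+ k)).
  apply: ler_sum => k _; rewrite expr_div_n mulrCA [X in X <= _]mulrC.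
  apply: ler_wpM2l; first exact: exprn_ge0.
  rewrite ler_pdivlMr ?exprn_gt0 //; apply: le_trans (aM k).
  by rewrite normrM normrX [`|s|]ger0_norm ?(ltW s0).
rewrite -mulr_sumr ler_wpM2l // geometric_sum_le //.
by rewrite divr_ge0 // ltW.
Qed.

(** Lets the factor n + 1 produced by differentiation be absorbed by a slightly larger radius [y],
    at the cost of dividing by [y - x]. *)
Lemma exp_deriv_le (x y : C) n : 0 <= x -> x <= y ->
  n.+1%:R * x ^+ n * (y - x) <= y ^+ n.+1.
Proof.
move=> x0 xy; have y0 := le_trans x0 xy.
elim: n => [|n IHn]; first by rewrite !mul1r expr1 lerBlDr lerDl.
have -> : n.+2%:R * x ^+ n.+1 * (y - x) =
   x * (n.+1%:R * x ^+ n * (y - x)) + x ^+ n.+1 * (y - x).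
  by rewrite !exprS -[n.+2]addn1 natrD; ring.
have -> : y ^+ n.+2 = x * y ^+ n.+1 + y ^+ n.+1 * (y - x) by rewrite !exprS; ring.
apply: lerD; first exact: ler_wpM2l.
by apply: ler_wpM2r; rewrite ?subr_ge0 // lerXn2r.
Qed.

Lemma abs_bounded_dcoef a r : abs_bounded a r -> abs_bounded (dcoef a) r.
Proof.
move=> ar rho rho0 rr; set s := (rho + r) / 2%:R.
have rs : rho < s by rewrite midf_lt.
have sr : s < r by rewrite midf_lt.
have s0 : 0 < s by apply: le_lt_trans rs.
have d0 : 0 < s - rho by rewrite subr_gt0.
have [B aB] := ar s (ltW s0) sr.
exists (B / (s - rho)) => n; rewrite ler_pdivlMr // mulr_suml.
apply: le_trans (aB n.+1); rewrite big_ord_recl.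
apply: le_trans (_ : \sum_(k < n) `|a k.+1| * s ^+ k.+1 <= _); last first.
  by rewrite lerDr mulr_ge0 // exprn_ge0 // ltW.
apply: ler_sum => k _; rewrite normrM normr_nat -!mulrA mulrCA.
apply: ler_wpM2l => //; rewrite mulrA; apply: exp_deriv_le => //; exact: ltW.
Qed.

(** Second-order Taylor remainder of a power. The remainder of the next power is [x] times the
    present one plus a multiple of [(x - y) ^+ 2]. The factor [n.+1%:R * n.+2%:R] is the one in
    [dcoef (dcoef a)], so the remainders sum to a bound by the twice derived series. *)
Lemma exp_diff_le (x y rho : C) n : `|x| <= rho -> `|y| <= rho ->
  `|x ^+ n.+2 - y ^+ n.+2 - n.+2%:R * y ^+ n.+1 * (x - y)|
    <= n.+1%:R * n.+2%:R * rho ^+ n * `|x - y| ^+ 2.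
Proof.
move=> xr yr; have r0 : 0 <= rho by apply: le_trans xr.
elim: n => [|n IHn].
  have -> : x ^+ 2 - y ^+ 2 - 2%:R * y ^+ 1 * (x - y) = (x - y) ^+ 2 by ring.
  by rewrite normrX expr0 mulr1 mul1r ler_peMl ?exprn_ge0 // ler1n.
have -> : x ^+ n.+3 - y ^+ n.+3 - n.+3%:R * y ^+ n.+2 * (x - y) =
  x * (x ^+ n.+2 - y ^+ n.+2 - n.+2%:R * y ^+ n.+1 * (x - y))
  + n.+2%:R * (y ^+ n.+1 * (x - y) ^+ 2).
  by rewrite !exprS -[n.+3]addn1 natrD; ring.
apply: le_trans (ler_normD _ _) _.
apply: (@le_trans _ _ (rho * (n.+1%:R * n.+2%:R * rho ^+ n * `|x - y| ^+ 2)
   + n.+2%:R * (rho ^+ n.+1 * `|x - y| ^+ 2))).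
  apply: lerD; first by rewrite normrM ler_pM.
  rewrite normrM normr_nat normrM !normrX; apply: ler_wpM2l; first exact: ler0n.
  apply: ler_wpM2r; first by rewrite exprn_ge0.
  by rewrite lerXn2r // ?nnegrE.
have -> : rho * (n.+1%:R * n.+2%:R * rho ^+ n * `|x - y| ^+ 2)
   + n.+2%:R * (rho ^+ n.+1 * `|x - y| ^+ 2) =
   n.+2%:R * n.+2%:R * (rho ^+ n.+1 * `|x - y| ^+ 2).
  by rewrite -[X in X%:R * _ * (rho ^+ n.+1 * _)]addn1 natrD [rho ^+ n.+1]exprS; ring.
rewrite -[leRHS]mulrA; apply: ler_wpM2r.
  by rewrite mulr_ge0 ?exprn_ge0.
by rewrite -!natrM ler_nat leq_mul2l leqnSn orbT.
Qed.

End PowerSeries.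

(** * Termwise differentiation of power series *)

Section PowerSeriesDerivative.
Variable R : realType.
Local Notation C := (Cplx R).
Implicit Types (a : nat -> C) (f g : C -> C) (z w h r B : C).

Lemma taylor_partial_sum a (x y : C) n :
  \sum_(k < n.+2) a k * x ^+ k - \sum_(k < n.+2) a k * y ^+ k
    - (\sum_(k < n.+1) dcoef a k * y ^+ k) * (x - y)
  = \sum_(k < n) a k.+2 *
      (x ^+ k.+2 - y ^+ k.+2 - k.+2%:R * y ^+ k.+1 * (x - y)).
Proof.
elim: n => [|n IHn].
  by rewrite !big_ord_recr !big_ord0 /= /dcoef !expr0 !expr1; ring.
rewrite [RHS]big_ord_recr -IHn [\sum_(k < n.+3) a k * x ^+ k]big_ord_recr.
rewrite [\sum_(k < n.+3) a k * y ^+ k]big_ord_recr.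
rewrite [\sum_(k < n.+2) dcoef a k * y ^+ k]big_ord_recr /=.
by rewrite [dcoef a n.+1]/dcoef; ring.
Qed.

(** The error of the linear approximation is at most a constant times [|h|^2]: this holds for
    partial sums by [taylor_partial_sum] and [exp_diff_le], uniformly in their length, and passes to
    the limit. *)
Lemma has_series_derive a f z r w : has_series a f z r -> `|w - z| < r ->
  exists2 l : C, series (fun n => dcoef a n * (w - z) ^+ n) @ \oo --> l
    & is_derive w 1 f l.
Proof.
move=> af wr; have ab := has_series_abs_bounded af.
have ab1 := abs_bounded_dcoef ab; have ab2 := abs_bounded_dcoef ab1.
have [l Dl] : exists l : C, series (fun n => dcoef a n * (w - z) ^+ n) @ \oo --> l.
  have [B aB] := ab1 _ (normr_ge0 _) wr.
  apply: (@cvg_series_absolute _ _ B) => n; apply: le_trans (aB n).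
  by apply: ler_sum => k _; rewrite normrM normrX.
exists l; first exact: Dl.
set rho := (`|w - z| + r) / 2%:R.
have wrho : `|w - z| < rho by rewrite midf_lt.
have rhor : rho < r by rewrite midf_lt.
have rho0 : 0 <= rho by apply: le_trans (ltW wrho).
have [B aB] := ab2 _ rho0 rhor.
have B0 : 0 <= B by have := aB 0%N; rewrite big_ord0.
have bound h : `|h| <= rho - `|w - z| -> `|f (w + h) - f w - l * h| <= B * `|h| ^+ 2.
  move=> hr; have whrho : `|w - z + h| <= rho.
    by rewrite (le_trans (ler_normD _ _)) // -lerBrDl.
  have shift (u : nat -> C) (l0 : C) : u @ \oo --> l0 -> (fun n => u n.+1) @ \oo --> l0.
    by move=> ul; rewrite (cvg_shiftS u).
  apply: (@cvg_norm_le _ (fun n =>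
      series (fun k => a k * (w + h - z) ^+ k) n.+2
    - series (fun k => a k * (w - z) ^+ k) n.+2
    - series (fun k => dcoef a k * (w - z) ^+ k) n.+1 * h)); last first.
    apply: cvgB.
      apply: cvgB.
        have := @af (w + h); rewrite addrAC => /(_ (le_lt_trans whrho rhor)).
        by move=> /shift /shift; rewrite addrAC.
      exact: (shift _ _ (shift _ _ (af w wr))).
    by apply: cvgM; [exact: shift | exact: cvg_cst].
  move=> n; rewrite !seriesEord /=.
  have {2}-> : h = w + h - z - (w - z) by ring.
  rewrite taylor_partial_sum (le_trans (ler_norm_sum _ _ _)) //.
  apply: le_trans (_ : (\sum_(k < n) `|dcoef (dcoef a) k| * rho ^+ k) * `|h| ^+ 2 <= _); last first.
    by apply: ler_wpM2r => //; rewrite exprn_ge0.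
  rewrite mulr_suml; apply: ler_sum => k _; rewrite normrM.
  have hE : w + h - z - (w - z) = h by ring.
  have := @exp_diff_le _ (w + h - z) (w - z) rho k; rewrite addrAC => /(_ whrho (ltW wrho)).
  rewrite addrAC hE => H.
  apply: le_trans (ler_wpM2l (normr_ge0 _) H) _.
  by rewrite /dcoef !normrM !normr_nat le_eqVlt; apply/orP; left; apply/eqP; ring.
suff dl : (fun t => t^-1 *: ((f \o shift w) (t *: 1) - f w)) @ 0^' --> l.
  by apply: DeriveDef; [apply/cvg_ex; exists l | apply/cvg_lim].
apply/(@cvgrPdist_le C C) => e e0.
have B1 : 0 < B + 1 by rewrite ltr_wpDl.
have d0 : 0 < rho - `|w - z| by rewrite subr_gt0.
near=> t.
have t0 : t != 0 by near: t; exact: nbhs_dnbhs_neq.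
have td : `|t| <= rho - `|w - z| by near: t; apply: dnbhs0_le.
(* Dividing by [B + 1] covers the case [B = 0]. *)
have te : `|t| <= e / (B + 1) by near: t; apply: dnbhs0_le; rewrite divr_gt0.
have -> : l - t^-1 *: ((f \o shift w) (t *: 1) - f w) =
    - (t^-1 * (f (w + t) - f w - l * t)).
  rewrite /= [t *: 1]mulr1 [t + w]addrC /GRing.scale /=; field.
  exact: t0.
rewrite normrN normrM normfV ler_pdivrMl ?normr_gt0 //.
apply: le_trans (bound _ td) _; rewrite expr2 mulrCA ler_wpM2l //.
apply: le_trans (_ : B * (e / (B + 1)) <= _); first exact: ler_wpM2l.
by rewrite mulrCA ger_pMr // ler_pdivrMr // mul1r lerDl.
Unshelve. all: by end_near. Qed.
End PowerSeriesDerivative.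

(** * Analytic functions: local constancy, chain rule and roots *)

Section Analytic.
Variable R : realType.
Local Notation C := (Cplx R).
Implicit Types (f g : C -> C) (z w t : C) (D : set C).

Lemma has_series_derive1 (a : nat -> C) f z r : has_series a f z r ->
  has_series (dcoef a) f^`()%classic z r.
Proof.
move=> af w wr; have [l al [_ fl]] := has_series_derive af wr.
by rewrite derive1E fl.
Qed.

Lemma analytic_at_derive1 f z : analytic_at f z -> analytic_at f^`()%classic z.
Proof.
move=> [a [r [r0 af]]]; exists (dcoef a), r; split; first exact: r0.
exact: has_series_derive1.
Qed.

Lemma analytic_at_derivable f z : analytic_at f z -> derivable f z 1.
Proof.
move=> [a [r [r0 af]]]; have zr : `|z - z| < r by rewrite subrr normr0.
by have [l _ []] := has_series_derive af zr.
Qed.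

Lemma cvg_series_constant_term (u : nat -> C) : (forall n, u n.+1 = 0) ->
  series u @ \oo --> u 0%N.
Proof.
move=> u0; rewrite -(cvg_shiftS (series u)).
rewrite (_ : [sequence series u n.+1]_n = cst (u 0%N)); first exact: cvg_cst.
by apply/funext => n; rewrite seriesEord /= big_ord_recl big1 ?addr0 // => i _; exact: u0.
Qed.

Lemma has_series_center (a : nat -> C) f z r : 0 < r -> has_series a f z r ->
  f z = a 0%N.
Proof.
move=> r0 af; have zr : `|z - z| < r by rewrite subrr normr0.
have := af z zr; rewrite subrr => fz.
have := @cvg_series_constant_term (fun n => a n * 0 ^+ n).
rewrite expr0 mulr1 => H; apply: (@norm_cvg_unique _ C _ _ _ _ fz); apply: H => n.
by rewrite expr0n mulr0.
Qed.

Lemma near_eq_derive1 f g z : (\forall w \near z, f w = g w) ->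
  f^`()%classic z = g^`()%classic z.
Proof. by move=> fg; rewrite !derive1E; exact: near_eq_derive. Qed.

Lemma near_eq0_derive1 f z : (\forall w \near z, f w = 0) ->
  \forall w \near z, f^`()%classic w = 0.
Proof.
move=> /near_join; apply: filterS => w f0.
by rewrite (@near_eq_derive1 _ (cst 0)) ?derive1_cst.
Qed.

(** Induction over [n] for all series at once: the constant term is the value at the center, and the
    later coefficients are, up to nonzero integers, those of the derivative, which also vanishes
    near [z]. *)
Lemma has_series_near0 (a : nat -> C) f z r : 0 < r -> has_series a f z r ->
  (\forall w \near z, f w = 0) -> forall n, a n = 0.
Proof.
move=> r0 af f0 n; elim: n a f af f0 => [|n IHn] a f af f0.
  by rewrite -(has_series_center r0 af) (nbhs_singleton f0).
have := IHn _ _ (has_series_derive1 af) (near_eq0_derive1 f0).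
by rewrite /dcoef => /eqP; rewrite mulf_eq0 pnatr_eq0 /= => /eqP.
Qed.

Lemma nbhs_distr_lt z r : 0 < r -> \forall w \near z, `|w - z| < r.
Proof.
by move=> r0; apply/(@nbhs_normP C C); exists r => //= w; rewrite /= distrC.
Qed.

Lemma analytic_locally_constant f z : analytic_at f z ->
  (\forall w \near z, f^`()%classic w = 0) -> \forall w \near z, f w = f z.
Proof.
move=> [a [r [r0 af]]] f0.
have Da0 := has_series_near0 r0 (has_series_derive1 af) f0.
have a0 n : a n.+1 = 0.
  by have /eqP := Da0 n; rewrite /dcoef mulf_eq0 pnatr_eq0 /= => /eqP.
near=> w; rewrite (has_series_center r0 af).
have wr : `|w - z| < r by near: w; exact: nbhs_distr_lt.
have := @cvg_series_constant_term (fun n => a n * (w - z) ^+ n).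
rewrite expr0 mulr1 => H; apply: (@norm_cvg_unique _ C _ _ _ _ (af w wr)).
by apply: H => n; rewrite a0 mul0r.
Unshelve. all: by end_near. Qed.

(** A level set and its complement in [D] are both open, so by connectedness a nonempty level set is
    all of [D]. On an empty [D] any constant serves. *)
Lemma locally_constant_on_domain D f : domain D ->
  (forall z, z \in D -> \forall w \near z, f w = f z) -> ~ nonconstant_on D f.
Proof.
move=> [oD cD] fl; apply; have [[z0 Dz0]|D0] := pselect (D !=set0); last first.
  by exists 0 => z /set_mem Dz; case: D0; exists z.
exists (f z0) => z /set_mem Dz.
have op (P : C -> Prop) : open [set x | D x /\ P (f x)].
  rewrite openE => x [Dx Px] /=; have fx := fl x (mem_set Dx).
  have Dn : \forall y \near x, D y by exact: open_nbhs_nbhs.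
  rewrite /interior; near=> y; split; first by near: y.
  by have -> : f y = f x by near: y.
suff : [set x | D x /\ f x = f z0] = D by move=> /seteqP[_ /(_ z Dz)[]].
apply: cD.
- by exists z0.
- exists [set x | D x /\ f x = f z0]; first exact: (op (fun y => y = f z0)).
  by apply/seteqP; split => x /= [].
- exists (~` [set x | D x /\ f x <> f z0]); first exact: (open_closedC (op (fun y => y <> f z0))).
  apply/seteqP; split => x /=; first by move=> [Dx fx]; split => // -[].
  by move=> [Dx nfx]; split => //; apply: contrapT => fx; apply: nfx.
Unshelve. all: by end_near. Qed.

Lemma is_deriveM_fun f g t (df dg : C) : is_derive t 1 f df -> is_derive t 1 g dg ->
  is_derive t 1 (fun s => f s * g s) (df * g t + f t * dg).
Proof.
move=> Hf Hg; have H := is_deriveM Hf Hg; apply: (is_derive_eq H).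
by rewrite /GRing.scale /= addrC [g t * _]mulrC.
Qed.

Lemma is_deriveD_fun f g t (df dg : C) : is_derive t 1 f df -> is_derive t 1 g dg ->
  is_derive t 1 (fun s => f s + g s) (df + dg).
Proof. by move=> Hf Hg; exact: (is_deriveD Hf Hg). Qed.

Lemma is_derive_horner (p : {poly C}) g t (dg : C) : is_derive t 1 g dg ->
  is_derive t 1 (fun s => p.[g s]) (p^`().[g t] * dg).
Proof.
move=> Hg; elim/poly_ind: p => [|p c IHp].
  rewrite deriv0 horner0 mul0r.
  rewrite (_ : (fun _ => _) = cst 0); first exact: is_derive_cst.
  by apply/funext => s; rewrite horner0.
rewrite (_ : (fun _ => _) = (fun s => p.[g s] * g s + c)); last first.
  by apply/funext => s; rewrite hornerMXaddC.
have H := is_deriveD_fun (is_deriveM_fun IHp Hg) (is_derive_cst c t 1).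
apply: (is_derive_eq H).
by rewrite derivD derivM derivX derivC addr0 mulr1 !hornerE; ring.
Qed.

Lemma is_derive_horner2 (P : poly2 C) f g t (df dg : C) :
  is_derive t 1 f df -> is_derive t 1 g dg ->
  is_derive t 1 (fun s => P.[f s, g s])
    ((polyDx P).[f t, g t] * df + (polyDy P).[f t, g t] * dg).
Proof.
move=> Hf Hg; elim/poly_ind: P => [|P c IHP].
  rewrite /polyDx /polyDy deriv0 map_poly0 !horner0 !mul0r addr0.
  rewrite (_ : (fun _ => _) = cst 0); first exact: is_derive_cst.
  by apply/funext => s; rewrite !horner0.
rewrite (_ : (fun _ => _) = (fun s => P.[f s, g s] * f s + c.[g s])); last first.
  by apply/funext => s; rewrite hornerMXaddC hornerD hornerM hornerC.
have H := is_deriveD_fun (is_deriveM_fun IHP Hf) (is_derive_horner c Hg).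
apply: (is_derive_eq H).
have -> : polyDy (P * 'X + c%:P) = polyDy P * 'X + (c^`())%:P.
  apply/polyP => i; rewrite coef_map_id0 ?deriv0 // !coefD !coefMX !coefC.
  by case: i => [|i] /=; rewrite ?add0r ?addr0 // coef_map_id0 ?deriv0.
rewrite /polyDx derivD derivM derivX derivC addr0 mulr1.
by rewrite !(hornerMXaddC, hornerD, hornerM, hornerX, hornerC); ring.
Qed.

Lemma near_neq0 f t (df : C) : is_derive t 1 f df -> f t != 0 ->
  \forall s \near t, f s != 0.
Proof.
move=> [/derivable1_diffP/differentiable_continuous fc _] ft.
exact: (@cvgr_neq0 C C C (nbhs t) _ f (f t) fc ft).
Qed.

(** Split off the full power of X - f(t) from [p]. The cofactor is nonzero at f(t), hence along [f]
    near [t] by continuity, so the power itself must vanish there. *)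
Lemma root_near_constant (p : {poly C}) f t (df : C) : p != 0 -> is_derive t 1 f df ->
  (\forall s \near t, p.[f s] = 0) -> \forall s \near t, f s = f t.
Proof.
move=> p0 Hf pf; have [m [q nr pE]] := multiplicity_XsubC p (f t).
rewrite p0 /= in nr.
have qf := near_neq0 (is_derive_horner q Hf) nr.
near=> s.
have : p.[f s] = 0 by near: s.
have qs : q.[f s] != 0 by near: s.
rewrite pE hornerM horner_exp hornerXsubC => /eqP.
by rewrite mulf_eq0 (negPf qs) /= expf_eq0 subr_eq0 => /andP[_ /eqP].
Unshelve. all: by end_near. Qed.
End Analytic.

(** * Uniformized curves *)

Section Curve.
Variable R : realType.
Local Notation C := (Cplx R).
Variables (F : poly2 C) (D : set C) (chi phi : C -> C).
Hypothesis F_irr : irreducible F.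
Hypothesis D_domain : domain D.
Hypothesis chi_an : analytic_on D chi.
Hypothesis phi_an : analytic_on D phi.
Hypothesis chi_nc : nonconstant_on D chi.
Hypothesis phi_nc : nonconstant_on D phi.
Hypothesis F0 : forall t, t \in D -> F.[chi t, phi t] = 0.

Lemma domain_nbhs t : t \in D -> \forall s \near t, s \in D.
Proof.
move=> /set_mem Dt; have [oD _] := D_domain.
have : \forall s \near t, D s by exact: open_nbhs_nbhs.
by apply: filterS => s /mem_set.
Qed.

Lemma analytic_on_derive1n (f : C -> C) n : analytic_on D f -> analytic_on D f^`(n)%classic.
Proof.
move=> fa; elim: n => [//|n IHn] t Dt.
by rewrite derive1nS; apply: analytic_at_derive1; exact: IHn.
Qed.

Lemma is_derive_derive1n (f : C -> C) n t : analytic_on D f -> t \in D ->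
  is_derive t 1 (f^`(n)%classic) (f^`(n.+1)%classic t).
Proof.
move=> fa Dt; rewrite derive1nS derive1E; apply: derivableP.
by apply: analytic_at_derivable; exact: analytic_on_derive1n.
Qed.

Lemma is_derive_analytic (f : C -> C) t : analytic_on D f -> t \in D ->
  is_derive t 1 f (f^`(1)%classic t).
Proof. by move=> fa Dt; exact: (is_derive_derive1n 0 fa Dt). Qed.

Lemma is_derive_zero (g : C -> C) t (dg : C) : (forall s, s \in D -> g s = 0) ->
  t \in D -> is_derive t 1 g dg -> dg = 0.
Proof.
move=> g0 Dt [_ <-]; rewrite -derive1E.
rewrite (@near_eq_derive1 _ _ (cst 0)) ?derive1_cst //.
by apply: filterS (domain_nbhs Dt) => s /g0.
Qed.

Lemma implicit_derivatives (X Y XX XY YY XXX XXY XYY YYY x1 x2 x3 y1 y2 y3 : C -> C) :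
  (forall t, t \in D -> [/\ is_derive t 1 x1 (x2 t), is_derive t 1 x2 (x3 t),
    is_derive t 1 y1 (y2 t) & is_derive t 1 y2 (y3 t)]) ->
  (forall t, t \in D -> is_derive t 1 X (XX t * x1 t + XY t * y1 t)
    /\ is_derive t 1 Y (XY t * x1 t + YY t * y1 t)) ->
  (forall t, t \in D -> [/\ is_derive t 1 XX (XXX t * x1 t + XXY t * y1 t),
     is_derive t 1 XY (XXY t * x1 t + XYY t * y1 t) &
     is_derive t 1 YY (XYY t * x1 t + YYY t * y1 t)]) ->
  (forall t, t \in D -> X t * x1 t + Y t * y1 t = 0) ->
  forall t, t \in D ->
   XX t * x1 t ^+ 2 + 2%:R * XY t * x1 t * y1 t + YY t * y1 t ^+ 2
     + X t * x2 t + Y t * y2 t = 0 /\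
   XXX t * x1 t ^+ 3 + 3%:R * XXY t * x1 t ^+ 2 * y1 t + 3%:R * XYY t * x1 t * y1 t ^+ 2
    + YYY t * y1 t ^+ 3 + 3%:R * XX t * x1 t * x2 t
    + 3%:R * XY t * (x1 t * y2 t + x2 t * y1 t)
    + 3%:R * YY t * y1 t * y2 t + X t * x3 t + Y t * y3 t = 0.
Proof.
move=> dxy dX dXX e1.
(* Products and a repeated summand replace the squares and the factor 2, so that the sum and product
   rules apply to this form as it stands. *)
have e2 t : t \in D ->
   XX t * (x1 t * x1 t) + (XY t * (x1 t * y1 t) + XY t * (x1 t * y1 t))
   + YY t * (y1 t * y1 t) + X t * x2 t + Y t * y2 t = 0.
  move=> Dt; have [d1 _ d1' _] := dxy t Dt; have [dX1 dY1] := dX t Dt.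
  have H := is_derive_zero e1 Dt
    (is_deriveD_fun (is_deriveM_fun dX1 d1) (is_deriveM_fun dY1 d1')).
  by apply: etrans H; ring.
move=> t Dt; split; first by apply: etrans (e2 t Dt); ring.
have [d1 d2 d1' d2'] := dxy t Dt; have [dX1 dY1] := dX t Dt.
have [dXX1 dXY1 dYY1] := dXX t Dt.
have dM := is_deriveM_fun dXY1 (is_deriveM_fun d1 d1').
have H := is_derive_zero e2 Dt (is_deriveD_fun (is_deriveD_fun (is_deriveD_fun
  (is_deriveD_fun (is_deriveM_fun dXX1 (is_deriveM_fun d1 d1)) (is_deriveD_fun dM dM))
  (is_deriveM_fun dYY1 (is_deriveM_fun d1' d1'))) (is_deriveM_fun dX1 d2))
  (is_deriveM_fun dY1 d2')).
by apply: etrans H; ring.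
Qed.

Lemma nonconstant_not_root (f : C -> C) (c : {poly C}) : analytic_on D f ->
  nonconstant_on D f -> c != 0 -> ~ (forall t, t \in D -> c.[f t] = 0).
Proof.
move=> fa fnc c0 cf; apply: (locally_constant_on_domain D_domain _ fnc) => t Dt.
apply: (root_near_constant c0 (is_derive_analytic fa Dt)).
by apply: filterS (domain_nbhs Dt) => s /cf.
Qed.

(** If [F] were free of x, it would be a nonzero polynomial in y vanishing along the nonconstant
    [phi]. *)
Lemma curve_sizeX : (1 < size F)%N.
Proof.
rewrite ltnNge; apply/negP => sF; have [Fn0 _ _] := F_irr.
have c0 : F`_0 != 0 by move: Fn0; rewrite {1}(size1_polyC sF) polyC_eq0.
apply: (nonconstant_not_root phi_an phi_nc c0) => t /F0.
by rewrite horner2_size1.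
Qed.

Lemma curve_sizeY : (1 < size (swapXY F))%N.
Proof.
rewrite ltnNge; apply/negP => sF; have [Fn0 _ _] := F_irr.
have c0 : (swapXY F)`_0 != 0.
  by move: Fn0; rewrite -swapXY_eq0 {1}(size1_polyC sF) polyC_eq0.
apply: (nonconstant_not_root chi_an chi_nc c0) => t /F0.
by rewrite -horner2_swapXY horner2_size1.
Qed.

Lemma near_phi_constant_absurd (h : {poly C}) t : t \in D -> phi^`(1)%classic t != 0 ->
  h != 0 -> ~ \forall s \near t, h.[phi s] = 0.
Proof.
move=> Dt p1 h0 hp; have := root_near_constant h0 (is_derive_analytic phi_an Dt) hp.
move=> /near_eq_derive1; rewrite derive1_cst => p0.
by move: p1; rewrite derive1n1 p0 eqxx.
Qed.

(* If chi' phi' vanished identically, chi would be a constant c near a point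
   with phi' <> 0, so x - c would divide F and chi would be c on all of D. *)
Lemma exists_regular_point : exists2 t, t \in D &
  chi^`(1)%classic t != 0 /\ phi^`(1)%classic t != 0.
Proof.
have [t Dt p1] : exists2 t, t \in D & phi^`(1)%classic t != 0.
  apply: contrapT => np; apply: (locally_constant_on_domain D_domain _ phi_nc) => t Dt.
  apply: analytic_locally_constant; first exact: phi_an.
  apply: filterS (domain_nbhs Dt) => s Ds.
  by apply: contrapT => /eqP ps; apply: np; exists s.
apply: contrapT => nreg.
have chi0 : \forall s \near t, chi^`()%classic s = 0.
  have pn := near_neq0 (is_derive_derive1n 1 phi_an Dt) p1.
  near=> s; have Ds : s \in D by near: s; exact: domain_nbhs.
  have ps : phi^`(1)%classic s != 0 by near: s; exact: pn.
  apply: contrapT => /eqP c1; apply: nreg.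
  by exists s; [exact: Ds | split; [exact: c1 | exact: ps]].
have chic := analytic_locally_constant (chi_an Dt) chi0.
have [Fc|Fc] := eqVneq F.[(chi t)%:P] 0; last first.
  apply: (near_phi_constant_absurd Dt p1 Fc).
  near=> s; have <- : chi s = chi t by near: s.
  by apply: F0; near: s; exact: domain_nbhs.
have [q Fq] := factor_polyC_root Fc; have [_ _ Firr] := F_irr.
have uq : q \is a GRing.unit.
  by have [//|uX] := Firr _ _ Fq; have := polyXsubC_non_unit (chi t)%:P; rewrite uX.
apply: chi_nc; exists (chi t) => s Ds; have := F0 Ds; rewrite Fq !hornerM.
rewrite hornerXsubC -polyCB hornerC => /eqP; rewrite mulf_eq0.
by rewrite (negPf (unit_horner2_neq0 _ _ uq)) subr_eq0 => /eqP.
Unshelve. all: by end_near. Qed.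

(** For each [P], [coprime_elim] gives a nonzero c(y) that vanishes wherever [P] does on the curve;
    [h] is the product of these. Near a regular point both derivatives stay nonzero, and [h] cannot
    vanish identically along [phi] there. *)
Lemma exists_good_point (s : seq (poly2 C)) : (forall P, P \in s -> ~ in_ideal F P) ->
  exists2 t, t \in D & [/\ chi^`(1)%classic t != 0, phi^`(1)%classic t != 0 &
    forall P, P \in s -> P.[chi t, phi t] != 0].
Proof.
move=> sF.
have [h h0 hs] : exists2 h : {poly C}, h != 0 & forall t, t \in D -> h.[phi t] != 0 ->
    forall P, P \in s -> P.[chi t, phi t] != 0.
  elim: s sF => [|P s IHs] sF; first by exists 1; rewrite ?oner_eq0.
  have [|h h0 hs] := IHs; first by move=> Q Qs; apply: sF; rewrite inE Qs orbT.
  have [|c c0 [u [v cE]]] := coprime_elim F_irr curve_sizeX (N := P).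
    by apply: sF; rewrite inE eqxx.
  exists (c * h) => [|t Dt]; first by rewrite mulf_neq0.
  rewrite hornerM mulf_eq0 negb_or => /andP[ct ht] Q; rewrite inE => /orP[/eqP->|]; last exact: hs.
  apply: contraNneq ct => Pt; have := congr1 (fun p : poly2 C => p.[chi t, phi t]) cE.
  by rewrite !(hornerD, hornerM, hornerC) F0 // Pt !mulr0 addr0 => ->.
have [t Dt [c1 p1]] := exists_regular_point.
have cn := near_neq0 (is_derive_derive1n 1 chi_an Dt) c1.
have pn := near_neq0 (is_derive_derive1n 1 phi_an Dt) p1.
apply: contrapT => ng; apply: (near_phi_constant_absurd Dt p1 h0).
have Dn := domain_nbhs Dt.
have Nt : \forall s \near t, s \in D /\ (chi^`(1)%classic s != 0 /\ phi^`(1)%classic s != 0).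
  by apply: filterI; [exact: Dn | apply: filterI; [exact: cn | exact: pn]].
move: Nt; apply: filterS => x [Dx [cx px]].
apply: contrapT => /eqP hx; apply: ng.
by exists x; [exact: Dx | split; [exact: cx | exact: px | exact: (hs x Dx hx)]].
Qed.

Lemma curve_derivatives t : t \in D ->
  let X := (polyDx F).[chi t, phi t] in let Y := (polyDy F).[chi t, phi t] in
  let XX := (polyDx (polyDx F)).[chi t, phi t] in
  let XY := (polyDy (polyDx F)).[chi t, phi t] in
  let YY := (polyDy (polyDy F)).[chi t, phi t] in
  let XXX := (polyDx (polyDx (polyDx F))).[chi t, phi t] in
  let XXY := (polyDy (polyDx (polyDx F))).[chi t, phi t] in
  let XYY := (polyDy (polyDy (polyDx F))).[chi t, phi t] in
  let YYY := (polyDy (polyDy (polyDy F))).[chi t, phi t] in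
  let x1 := chi^`(1)%classic t in let x2 := chi^`(2)%classic t in
  let x3 := chi^`(3)%classic t in
  let y1 := phi^`(1)%classic t in let y2 := phi^`(2)%classic t in
  let y3 := phi^`(3)%classic t in
  [/\ X * x1 + Y * y1 = 0,
   XX * x1 ^+ 2 + 2%:R * XY * x1 * y1 + YY * y1 ^+ 2 + X * x2 + Y * y2 = 0 &
   XXX * x1 ^+ 3 + 3%:R * XXY * x1 ^+ 2 * y1 + 3%:R * XYY * x1 * y1 ^+ 2
    + YYY * y1 ^+ 3 + 3%:R * XX * x1 * x2 + 3%:R * XY * (x1 * y2 + x2 * y1)
    + 3%:R * YY * y1 * y2 + X * x3 + Y * y3 = 0].
Proof.
pose ev (P : poly2 C) s := P.[chi s, phi s].
have dP (P : poly2 C) s : s \in D -> is_derive s 1 (ev P)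
    (ev (polyDx P) s * chi^`(1)%classic s + ev (polyDy P) s * phi^`(1)%classic s).
  by move=> Ds; apply: is_derive_horner2; exact: is_derive_analytic.
have dc n s : s \in D -> is_derive s 1 chi^`(n)%classic (chi^`(n.+1)%classic s).
  by move=> Ds; exact: is_derive_derive1n.
have dp n s : s \in D -> is_derive s 1 phi^`(n)%classic (phi^`(n.+1)%classic s).
  by move=> Ds; exact: is_derive_derive1n.
have e1 s : s \in D -> ev (polyDx F) s * chi^`(1)%classic s
    + ev (polyDy F) s * phi^`(1)%classic s = 0.
  by move=> Ds; exact: (is_derive_zero F0 Ds (dP F s Ds)).
move=> Dt; have H := @implicit_derivatives (ev (polyDx F)) (ev (polyDy F))
  (ev (polyDx (polyDx F))) (ev (polyDy (polyDx F))) (ev (polyDy (polyDy F)))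
  (ev (polyDx (polyDx (polyDx F)))) (ev (polyDy (polyDx (polyDx F))))
  (ev (polyDy (polyDy (polyDx F)))) (ev (polyDy (polyDy (polyDy F))))
  chi^`(1)%classic chi^`(2)%classic chi^`(3)%classic
  phi^`(1)%classic phi^`(2)%classic phi^`(3)%classic.
have [s Ds|s Ds|s Ds|E2 E3] := H _ _ _ e1 t Dt.
- by split; [exact: dc | exact: dc | exact: dp | exact: dp].
- split; first exact: dP.
  by have := dP (polyDy F) s Ds; rewrite polyDxDy.
- split; first exact: dP.
    by have := dP (polyDy (polyDx F)) s Ds; rewrite polyDxDy.
  by have := dP (polyDy (polyDy F)) s Ds; rewrite !polyDxDy.
by split; [exact: e1 | exact: E2 | exact: E3].
Qed.
End Curve.

(** * The relation modulo the curve *)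

Lemma horner2_relation_num (K : fieldType) (n1 m1 n2 m2 F : poly2 K) (x y : K) :
  (curve_relation F n1 m1 n2 m2).[x, y] =
  relation_num n1.[x, y] m1.[x, y] n2.[x, y] m2.[x, y]
   (polyDx F).[x, y] (polyDy F).[x, y] (polyDx (polyDx F)).[x, y]
    (polyDy (polyDx F)).[x, y] (polyDy (polyDy F)).[x, y] (polyDx (polyDx (polyDx F))).[x, y]
    (polyDy (polyDx (polyDx F))).[x, y] (polyDy (polyDy (polyDx F))).[x, y]
    (polyDy (polyDy (polyDy F))).[x, y].
Proof. exact: (relation_num_rmorph (horner_eval y \o horner_eval x%:P)). Qed.

Theorem mainTheorem3 (R : realType) (F : poly2 (Cplx R))
    (D : set (Cplx R)) (chi phi : Cplx R -> Cplx R)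
    (Q1 Q2 : ratfun (Cplx R)) :
  irreducible F ->
  domain D ->
  analytic_on D chi -> analytic_on D phi ->
  nonconstant_on D chi -> nonconstant_on D phi ->
  (forall tau, tau \in D -> F.[chi tau, phi tau] = 0) ->
  defined_on_curve F Q1 -> defined_on_curve F Q2 ->
  satisfies_ode D chi phi chi Q1 ->
  satisfies_ode D chi phi phi Q2 ->
  let Fx := Dx F%:F in
  let Fy := Dy F%:F in
  eq_mod F
    ((Q1 + partial_schwarzian Dx F%:F) * (Fy / Fx)
       - (Q2 + partial_schwarzian Dy F%:F) * (Fx / Fy))
    (3%:R * ln_xy (Fx / Fy)).
Proof.
move=> Firr Ddom chia phia chinc phinc F0 [n1 [m1 [Fm1 Q1E]]] [n2 [m2 [Fm2 Q2E]]].
move=> ode1 ode2 Fx Fy.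
have good := exists_good_point Firr Ddom chia phia chinc phinc F0.
have FX : ~ in_ideal F (polyDx F).
  move=> /in_ideal_polyDx; apply/negP; rewrite -ltnNge.
  exact: (curve_sizeX Firr Ddom phia phinc F0).
have FY : ~ in_ideal F (polyDy F).
  move=> /in_ideal_polyDy; apply/negP; rewrite -ltnNge.
  exact: (curve_sizeY Firr Ddom chia chinc F0).
have nz p : ~ in_ideal F p -> p != 0.
  by move=> Fp; apply: contra_notN Fp => /eqP->; exists 0; rewrite mulr0.
set N := curve_relation F n1 m1 n2 m2.
(* The nonconstant factors of the common denominator; none may vanish at the point where the field
   identity is used. *)
pose bad := [:: m1; m2; polyDx F; polyDy F].
have badF P : P \in bad -> ~ in_ideal F P.
  by rewrite !inE => /or4P[] /eqP ->.
have bad_neq0 t : (forall P, P \in bad -> P.[chi t, phi t] != 0) ->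
    [/\ m1.[chi t, phi t] != 0, m2.[chi t, phi t] != 0,
        (polyDx F).[chi t, phi t] != 0 & (polyDy F).[chi t, phi t] != 0].
  by move=> mem; split; apply: mem; rewrite !inE eqxx ?orbT.
(* Otherwise [N] could join the list of polynomials to be kept nonzero, and at the resulting point
   [relation_num_eq0] would contradict this. *)
have [q NE] : in_ideal F N.
  apply: contrapT => FN.
  have [|t Dt [x1 y1 nz_t]] := good (N :: bad).
    by move=> P; rewrite inE => /orP[/eqP ->|/badF].
  have [|m1t m2t Xt Yt] := bad_neq0 t.
    by move=> P Pbad; apply: nz_t; rewrite inE Pbad orbT.
  have /eqP[] : N.[chi t, phi t] != 0 by apply: nz_t; rewrite inE eqxx.
  have [e1 e2 e3] := curve_derivatives Ddom chia phia F0 Dt.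
  have two : 2%:R != 0 :> Cplx R by rewrite pnatr_eq0.
  have q1 : mero_derivative chi t = n1.[chi t, phi t] / m1.[chi t, phi t].
    by apply: ode1; [exact: Dt | exact: x1 | exists n1, m1].
  have q2 : mero_derivative phi t = n2.[chi t, phi t] / m2.[chi t, phi t].
    by apply: ode2; [exact: Dt | exact: y1 | exists n2, m2].
  rewrite horner2_relation_num.
  exact: (relation_num_eq0 two m1t m2t Xt Yt x1 y1 e1 e2 e3 q1 q2).
exists q, (2%:R * m1 * m2 * polyDx F ^+ 3 * polyDy F ^+ 3); split; last first.
  by rewrite -NE Q1E Q2E; apply: curve_relationE; exact: nz.
(* A multiple of [F] vanishes at every point of the curve, whereas the denominator is a product of
   factors that are nonzero at a good point. *)
move=> [p ME]; have [t Dt [_ _ nz_t]] := good bad badF.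
have := congr1 (fun P : poly2 (Cplx R) => P.[chi t, phi t]) ME.
rewrite [in RHS]hornerM [in RHS]hornerM F0 // mul0r => /eqP.
have -> : 2%:R = 2%:R%:P%:P :> poly2 (Cplx R) by rewrite !polyC_natr.
rewrite !(hornerM, horner_exp, hornerC); apply/negP.
have [m1t m2t Xt Yt] := bad_neq0 t nz_t.
by rewrite !mulf_neq0 // ?pnatr_eq0.
Qed.
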